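(* Let $H$ be a time-independent, hermitian, number-parity-preserving Hamiltonian on $h$. Define $$e^{i\mathcal S}:=e^{i\epsilon\mathcal P}\prod_{t=0}^{N-1}e^{-i\epsilon H_t},\qquad \mathcal V:=\prod_{t=0}^{N-1}e^{i\epsilon tH_t}.$$ Then $$e^{i\mathcal S}=e^{-iTH_0}\,\mathcal V^\dagger e^{i\epsilon\mathcal P}\mathcal V.$$
   Context: Fix integers $L\ge1$, $N\ge1$, a real $\epsilon>0$, and set $T=\epsilon N$. The space $h$. Let $h$ be the fermionic Fock space of $L$ modes with ladder operators $a_i$ satisfying $\{a_i,a_j^\dagger\}=\delta_{ij}$ and $\{a_i,a_j\}=\{a_i^\dagger,a_j^\dagger\}=0$. The space $\mathcal H$. Let $\mathcal H$ be the Fock space generated from a vacuum $|\Omega\rangle$ by $a_{ti}$, $t=0,\dots,N-1$, $i=1,\dots,L$, with $\{a_{ti},a^\dagger_{t'j}\}=\delta_{tt'}\delta_{ij}$ and all other anticommutators zero. Time translations. Set $\omega_n=(2n+1)\pi/T$ and $\hat a_{ni}=N^{-1/2}\sum_te^{i\omega_n\epsilon t}a_{ti}$. Define $$\mathcal P=\sum_{n,j}\omega_n\hat a^\dagger_{nj}\hat a_{nj}.$$ Parity-preserving Hamiltonians on slices. A Hamiltonian $H$ is parity preserving if it is an even polynomial in the ladder operators, i.e. each monomial has an even number of factors. $H_t$ denotes $H$ placed on slice $t$: its image under the unital $*$-homomorphism determined by $a_i\mapsto a_{ti}$. In particular, $H_0$ is $H$ acting on slice $0$. *)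

(* Defs.v *)
From HB Require Import structures.
From mathcomp Require Import all_boot all_order all_algebra.
From mathcomp Require Import all_classical all_reals all_analysis.
From mathcomp Require Import complex.
Unset Printing Implicit Defensive.
Import Order.TTheory GRing.Theory Num.Theory.
Import numFieldNormedType.Exports.
Local Open Scope ring_scope.
Local Open Scope complex_scope.

Section Fock.
Variable R : realType.
Local Notation C := R[i].

Definition adj {n : nat} (A : 'M[C]_n) : 'M[C]_n := (map_mx Num.conj A)^T.

Definition mexp {n : nat} (A : 'M[C]_n) : 'M[C]_n :=
  limn (series (fun k : nat => (k`!%:R)^-1 *: A ^+ k)).

Definition iC : C := 0 +i* 1.

Definition cexpi (th : R) : C := cos th +i* sin th.

(* occupation of mode m in the basis state with index c (binary digits) *)
Definition occ (m c : nat) : bool := odd (c %/ 2 ^ m).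

(* Fermionic Fock space of M modes = C^(2^M) with occupation-number basis;
   annihilation operator of mode m via the Jordan-Wigner construction:
   a_m |c> = (-1)^(# occupied modes j < m) |c - 2^m>  if mode m occupied, else 0 *)
Definition ann (M m : nat) : 'M[C]_(2 ^ M) :=
  \matrix_(r < 2 ^ M, c < 2 ^ M)
    (if occ m c && (r == (c - 2 ^ m)%N :> nat)
     then (-1) ^+ (\sum_(j < m) (occ j c : nat))%N else 0).

(* noncommutative polynomials in ladder operators a_i, a_i^dagger (i < L):
   a list of (coefficient, word); a letter (true, i) is a_i^dagger,
   (false, i) is a_i *)
Definition ladder_poly (L : nat) := seq (C * seq (bool * 'I_L)).

Definition eval_word {L n : nat} (a : 'I_L -> 'M[C]_n) (w : seq (bool * 'I_L))
  : 'M[C]_n :=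
  foldr (fun l acc => (if l.1 then adj (a l.2) else a l.2) * acc) 1 w.

Definition eval_poly {L n : nat} (a : 'I_L -> 'M[C]_n) (p : ladder_poly L)
  : 'M[C]_n :=
  \sum_(m <- p) m.1 *: eval_word a m.2.

Definition parity_even {L : nat} (p : ladder_poly L) : bool :=
  all (fun m => ~~ odd (size m.2)) p.

Definition a_sl (N L : nat) (t : nat) (i : 'I_L) : 'M[C]_(2 ^ (N * L)) :=
  ann (N * L) (t * L + i).

Definition H_slice (N : nat) {L : nat} (p : ladder_poly L) (t : nat)
  : 'M[C]_(2 ^ (N * L)) := eval_poly (a_sl N L t) p.

Definition omega (eps : R) (N n : nat) : R := (2 * n + 1)%:R * pi / (eps * N%:R).

Definition ahat (eps : R) (N L n : nat) (j : 'I_L) : 'M[C]_(2 ^ (N * L)) :=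
  ((Num.sqrt (N%:R : R))^-1)%:C *:
    \sum_(t < N) cexpi (omega eps N n * eps * t%:R) *: a_sl N L t j.

(* the time-translation generator P = sum_{n,j} omega_n ahat^dag ahat *)
Definition Pgen (eps : R) (N L : nat) : 'M[C]_(2 ^ (N * L)) :=
  \sum_(n < N) \sum_(j < L)
    (omega eps N n)%:C *: (adj (ahat eps N L n j) * ahat eps N L n j).

End Fock.

Arguments adj {R n}.
Arguments mexp {R n}.
Arguments cexpi {R}.
Arguments iC {R}.
Arguments eval_word {R L n}.
Arguments eval_poly {R L n}.
Arguments parity_even {R L}.
Arguments H_slice {R} N {L}.
Arguments omega {R}.
Arguments ahat {R}.
Arguments Pgen {R}.

(* Main.v *)
(** The anticommutation relations give [P, ahat_n] = - omega_n ahat_n, so that U := e^{i eps P}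
    multiplies ahat_n by e^{- i eps omega_n} under conjugation. Inverting the Fourier transform,
    U a_t U^-1 = a_{t+1}, with a sign -1 when the index wraps around from N to 0. An even polynomial
    does not see the sign, hence U H_t U^-1 = H_{t+1 mod N}. The H_t are hermitian and commute with
    each other, also by evenness, so V^dag (U V U^-1) collapses to
    e^{i eps (N-1) H_0} prod_{t>=1} e^{-i eps H_t}, and the prefactor e^{-i T H_0} turns this into
    prod_t e^{-i eps H_t}, which commutes with U. *)

Require Import Defs.
From HB Require Import structures.
From mathcomp Require Import all_boot all_order all_algebra.
From mathcomp Require Import all_classical all_reals all_analysis.
From mathcomp Require Import complex ring spectral sesquilinear.
Set Implicit Arguments.
Unset Strict Implicit.
Unset Printing Implicit Defensive.
Import Order.TTheory GRing.Theory Num.Theory.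
Import numFieldNormedType.Exports.
Local Open Scope ring_scope.
Local Open Scope complex_scope.

(** * Convergence of the exponential series, for scalars and diagonalizable matrices *)

Lemma cvg_real_complex (R : realType) (u : nat -> R) (l : R) :
  (u @ \oo --> l -> (fun k => (u k)%:C : (R[i] : numFieldType)) @ \oo --> (l%:C : (R[i] : numFieldType)))%classic.
Proof.
move=> /cvgrPdist_lt ul; apply/cvgrPdist_lt => e e0.
(* A positive element of [R[i]] is real, so the tolerance can be compared with a real distance. *)
have [eR eE] : 0 < complex.Re e /\ e = (complex.Re e)%:C.
  by move: e0; rewrite ltcE /= => /andP[/eqP e0 ->]; split => //; case: e e0 => a b /= ->.
near=> k; rewrite -rmorphB /= normc_def /= expr0n addr0 sqrtr_sqr eE ltcR.
by near: k; exact: ul.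
Unshelve. all: by end_near. Qed.

(** Even powers of i produce the cosine series and odd powers the sine series, partial sum by
    partial sum. *)
Lemma cvg_series_cexpi (R : realType) (x : R) :
  (series (fun k : nat => (k`!%:R)^-1 * (iC * x%:C) ^+ k : (R[i] : numFieldType)) @ \oo -->
     (cexpi x : (R[i] : numFieldType)))%classic.
Proof.
have -> : cexpi x = (cos x)%:C + iC * (sin x)%:C :> R[i].
  by apply/eqP; rewrite eq_complex /=; apply/andP; split; apply/eqP; rewrite /=; ring.
have -> : series (fun k : nat => (k`!%:R)^-1 * (iC * x%:C) ^+ k) =
   (fun k => (series (cos_coeff x) k)%:C) \+ (fun k => iC * (series (sin_coeff x) k)%:C).
  apply/funext => n /=; rewrite /series /= !rmorph_sum mulr_sumr -big_split /=.
  apply: eq_bigr => k _; rewrite exprMn /cos_coeff /sin_coeff /=.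
  have i2 : iC ^+ 2 = -1 :> R[i] by exact: sqr_i.
  (* Shaped after [cos_coeff] and [sin_coeff]: the parity of [k] keeps exactly one summand, and
     [k.-1./2] is [k./2] for odd [k]. *)
  have ik : iC ^+ k = ((~~ odd k)%:R * (-1) ^+ k./2)%:C
                    + iC * ((odd k)%:R * (-1) ^+ k.-1./2)%:C :> R[i].
    rewrite -[in LHS](odd_double_half k) exprD -mul2n exprM i2.
    case: (boolP (odd k)) => ko /=.
      have -> : (k.-1./2 = k./2)%N by rewrite -[in LHS](odd_double_half k) ko /= doubleK.
      by rewrite expr1 mul0r mul1r add0r rmorphXn /= rmorphN1.
    by rewrite expr0 mul1r mul0r mul1r mulr0 addr0 rmorphXn /= rmorphN1.
  have k0 : (k`!%:R : R[i]) != 0 by rewrite pnatr_eq0 -lt0n fact_gt0.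
  have invC : (k`!%:R^-1 : R)%:C = k`!%:R^-1 :> R[i].
    by rewrite fmorphV rmorph_nat.
  have xk : (x ^+ k)%:C = x%:C ^+ k :> R[i] by rewrite rmorphXn.
  have CM (a b : R) : (a * b)%:C = a%:C * b%:C by rewrite rmorphM.
  by rewrite ik -exprnP !CM invC xk; ring.
apply: cvgD.
  apply: cvg_real_complex; rewrite cos.unlock; exact: is_cvg_series_cos_coeff.
apply: cvgMl_tmp; apply: cvg_real_complex.
rewrite sin.unlock; exact: is_cvg_series_sin_coeff.
Qed.

Lemma cvg_mx (K : numFieldType) m n (F : nat -> 'M[K]_(m, n)) (M : 'M[K]_(m, n)) :
  (forall i j, (fun k => F k i j) @ \oo --> M i j)%classic -> (F @ \oo --> M)%classic.
Proof.
move=> FM; apply/cvg_mx_entourageP => A entA.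
suff : (\forall k \near \oo, forall i j, (M i j, F k i j) \in A)%classic by [].
apply: (@filter_forall nat 'I_m (fun i k => forall j, (M i j, F k i j) \in A) \oo%classic) => i.
apply: (@filter_forall nat 'I_n (fun j k => (M i j, F k i j) \in A) \oo%classic) => j.
have /cvg_app_entourageP /(_ A entA) := FM i j.
by apply: (@filterS _ \oo%classic) => k; rewrite inE.
Qed.

Lemma mulmx_similar_diag (K : fieldType) n (P : 'M[K]_n) (d e : 'rV[K]_n) :
  P \in unitmx ->
  (invmx P *m diag_mx d *m P) *m (invmx P *m diag_mx e *m P) =
  invmx P *m diag_mx (\row_i (d 0 i * e 0 i)) *m P.
Proof.
by move=> Pu; rewrite !mulmxA mulmxK // -[_ *m _ *m diag_mx e]mulmxA mulmx_diag.
Qed.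

Lemma exprmx_similar (K : fieldType) n (P : 'M[K]_n) (d : 'rV[K]_n) k :
  P \in unitmx ->
  (invmx P *m diag_mx d *m P) ^+ k = invmx P *m diag_mx (map_mx (fun z : K => z ^+ k) d) *m P.
Proof.
move=> Pu; elim: k => [|k IH].
  have -> : map_mx (fun z : K => z ^+ 0) d = const_mx 1 by apply/rowP => i; rewrite !mxE expr0.
  by rewrite diag_const_mx mulmx1 mulVmx.
rewrite exprS IH -mulmxE mulmx_similar_diag //.
by congr (_ *m diag_mx _ *m _); apply/rowP => i; rewrite !mxE exprS.
Qed.

(** [mexp] is a limit, so its value is known only once convergence is shown. Each entry of a partial
    sum is a fixed linear combination of the scalar partial sums at the eigenvalues. *)
Lemma mexp_similar (R : realType) n (P : 'M[R[i]]_n) (d e : 'rV[R[i]]_n) :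
  P \in unitmx ->
  (forall l, series (fun k : nat => (k`!%:R)^-1 * (d 0 l) ^+ k : (R[i] : numFieldType)) @ \oo -->
     (e 0 l : (R[i] : numFieldType)))%classic ->
  mexp (invmx P *m diag_mx d *m P) = invmx P *m diag_mx e *m P.
Proof.
move=> Pu de; apply: (@cvg_lim ('M[R[i] : numFieldType]_n : normedModType (R[i] : numFieldType))
  (@norm_hausdorff _ _)).
apply: (@cvg_mx (R[i] : numFieldType)) => i j.
have -> : (fun k => (series (fun k0 => k0`!%:R^-1 *: (invmx P *m diag_mx d *m P) ^+ k0) k) i j)
  = (fun k => \sum_l (invmx P i l * P l j) * (series (fun k : nat => (k`!%:R)^-1 * (d 0 l) ^+ k) k)).
  apply/funext => n0; rewrite /series /= summxE.
  under [LHS]eq_bigr => k _.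
    rewrite mxE (exprmx_similar d k Pu) mul_mx_diag mxE mulr_sumr.
    under eq_bigr => l _ do rewrite !mxE.
    over.
  rewrite exchange_big /=; apply: eq_bigr => l _; rewrite mulr_sumr.
  by apply: eq_bigr => k _; ring.
have -> : (invmx P *m diag_mx e *m P) i j = \sum_l (invmx P i l * P l j) * e 0 l.
  rewrite mul_mx_diag mxE; apply: eq_bigr => l _; rewrite !mxE; ring.
apply: cvg_big => [|l _]; first exact: add_continuous.
by apply: cvgMl_tmp; exact: de.
Qed.

(** * Phases of modulus one *)

Section ComplexPhase.
Variable R : realType.
Implicit Types x y : R.

Lemma cexpi0 : cexpi 0 = 1 :> R[i].
Proof. by rewrite /cexpi cos0 sin0. Qed.

Lemma cexpiD x y : cexpi (x + y) = cexpi x * cexpi y.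
Proof.
rewrite /cexpi cosD sinD; apply/eqP; rewrite eq_complex /=.
by rewrite !eqxx /= [X in _ == X]addrC eqxx.
Qed.

Lemma conj_cexpi x : Num.conj (cexpi x) = cexpi (- x).
Proof. by rewrite /cexpi cosN sinN. Qed.

Lemma conj_real_complex x : Num.conj (x%:C) = x%:C :> R[i].
Proof. exact: conjc_real. Qed.

End ComplexPhase.

(** * Algebra of the adjoint *)

Section Adjoint.
Variables (R : realType) (n : nat).
Local Notation C := R[i].
Implicit Types A B : 'M[C]_n.

Lemma adjE A i j : adj A i j = Num.conj (A j i).
Proof. by rewrite !mxE. Qed.

Lemma adjK : involutive (@adj R n).
Proof. by move=> A; apply/matrixP => i j; rewrite !adjE conjCK. Qed.

Lemma adj_is_additive : additive (@adj R n).
Proof. by move=> A B; apply/matrixP => i j; rewrite !(mxE, adjE) rmorphB. Qed.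

HB.instance Definition _ := GRing.isAdditive.Build _ _ (@adj R n) adj_is_additive.

Lemma adjM A B : adj (A * B) = adj B * adj A.
Proof. by rewrite /adj -!mulmxE map_mxM trmx_mul. Qed.

Lemma adjZ c A : adj (c *: A) = Num.conj c *: adj A.
Proof. by apply/matrixP => i j; rewrite !(mxE, adjE) rmorphM. Qed.

Lemma mxscaleAl c A B : c *: (A * B) = (c *: A) * B.
Proof. exact: scalemxAl. Qed.

Lemma mxscaleAr c A B : c *: (A * B) = A * (c *: B).
Proof. exact: scalemxAr. Qed.

Lemma adj1 : adj (1 : 'M[C]_n) = 1.
Proof. by rewrite /adj map_mx1 trmx1. Qed.

End Adjoint.

(** * One-parameter groups generated by hermitian matrices *)

Section UnitaryGroup.
Variables (R : realType).
Local Notation C := R[i].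

Definition mexpi n (x : R) (A : 'M[C]_n) := mexp (iC * x%:C *: A).

Variable n : nat.
Implicit Types A B X : 'M[C]_n.

Lemma mexpiN x A : mexpi (- x) A = mexp (- (iC * x%:C) *: A).
Proof. by rewrite /mexpi rmorphN mulrN. Qed.

(** The spectral theorem, with the eigenvalues given as real numbers so that exponentials become
    phases [cexpi]. *)
Lemma hermitian_diagonalizable A : adj A = A ->
  exists P (d : 'I_n -> R), [/\ P \in unitmx, adj P = invmx P
    & A = invmx P *m diag_mx (\row_i (d i)%:C) *m P].
Proof.
move=> hA; have hsym : A \is hermsymmx.
  apply/is_hermitianmxP; rewrite expr0 scale1r -[in LHS]hA /adj.
  by rewrite map_trmx.
exists (spectralmx A), (fun i => complex.Re (spectral_diag A 0 i)); split.
- exact: spectral_unit.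
- by rewrite invmx_unitary ?spectral_unitarymx // /adj map_trmx.
have <- : spectral_diag A = \row_i (complex.Re (spectral_diag A 0 i))%:C.
  apply/rowP => i; rewrite mxE; apply/esym/RRe_real.
  by have /mxOverP := hermitian_spectral_diag_real hsym; apply.
exact: (orthomx_spectralP (hermitian_normalmx hsym)).
Qed.

Lemma mexpi_diag P (d : 'I_n -> R) x : P \in unitmx ->
  mexpi x (invmx P *m diag_mx (\row_i (d i)%:C) *m P) =
  invmx P *m diag_mx (\row_i cexpi (x * d i)) *m P.
Proof.
move=> Pu; rewrite /mexpi scalemxAl scalemxAr -linearZ /=.
apply: (mexp_similar Pu) => l; rewrite !mxE -mulrA -rmorphM.
exact: cvg_series_cexpi.
Qed.

(* In eigenbases of A and B the hypothesis reads Y_ij a_j = (b_i + c) Y_ij, where Y is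
   the matrix of X: the eigenvalues are related wherever Y_ij does not vanish. *)
Lemma mexpi_intertwine A B X (c x : R) : adj A = A -> adj B = B ->
  X * A = B * X + c%:C *: X ->
  X * mexpi x A = cexpi (x * c) *: (mexpi x B * X).
Proof.
move=> /hermitian_diagonalizable [P [a [Pu _ ->]]].
move=> /hermitian_diagonalizable [Q [b [Qu _ ->]]].
rewrite !mexpi_diag // -!mulmxE => XAB.
have [Y XY] : exists Y, X = invmx Q *m Y *m P.
  by exists (Q *m X *m invmx P); rewrite !mulmxA mulVmx // mul1mx mulmxKV.
have YAB i j : Y i j * (a j)%:C = ((b i)%:C + c%:C) * Y i j.
  have : Y *m diag_mx (\row_i (a i)%:C) = diag_mx (\row_i (b i)%:C) *m Y + c%:C *: Y.
    have Qi : invmx Q \in unitmx by rewrite unitmx_inv.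
    apply: (can_inj (mulKmx Qi)).
    apply: (can_inj (mulmxK Pu)).
    have -> : invmx Q *m (Y *m diag_mx (\row_i (a i)%:C)) *m P = X *m (invmx P *m diag_mx (\row_i (a i)%:C) *m P).
      by rewrite XY !mulmxA mulmxK.
    rewrite XAB mulmxDr mulmxDl -scalemxAr -scalemxAl -XY; congr (_ + _).
    by rewrite XY !mulmxA mulmxK.
  move=> /matrixP /(_ i j); rewrite mul_mx_diag mul_diag_mx !mxE => ->.
  by ring.
suff YE : Y *m diag_mx (\row_i cexpi (x * a i)) =
    cexpi (x * c) *: (diag_mx (\row_i cexpi (x * b i)) *m Y).
  rewrite XY !mulmxA !mulmxK // -(mulmxA _ Y) YE.
  by rewrite -scalemxAr -scalemxAl !mulmxA.
apply/matrixP => i j; rewrite mul_mx_diag mul_diag_mx !mxE.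
have [->|Y0] := eqVneq (Y i j) 0; first by rewrite !(mul0r, mulr0).
have /complexI -> : (a j)%:C = (b i + c)%:C.
  by apply: (mulfI Y0); rewrite YAB rmorphD /= mulrC.
by rewrite mulrDr cexpiD; ring.
Qed.

Lemma mexpiD A x y : adj A = A -> mexpi (x + y) A = mexpi x A * mexpi y A.
Proof.
move=> /hermitian_diagonalizable [P [a [Pu _ ->]]].
rewrite (mexpi_diag _ _ Pu) (mexpi_diag _ _ Pu) (mexpi_diag _ _ Pu).
apply: etrans (esym (mulmx_similar_diag _ _ Pu)).
apply: (congr1 (fun v => invmx P *m diag_mx v *m P)).
by apply/rowP => i; rewrite !mxE mulrDl cexpiD.
Qed.

Lemma mexpi0 A : adj A = A -> mexpi 0 A = 1.
Proof.
move=> /hermitian_diagonalizable [P [a [Pu _ ->]]]; rewrite mexpi_diag //.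
have -> : \row_i cexpi (0 * a i) = const_mx 1.
  by apply/rowP => i; rewrite !mxE mul0r cexpi0.
by rewrite diag_const_mx mulmx1 mulVmx.
Qed.

Lemma adj_mexpi A x : adj A = A -> adj (mexpi x A) = mexpi (- x) A.
Proof.
move=> /hermitian_diagonalizable [P [a [Pu Pa ->]]]; rewrite !(mexpi_diag _ _ Pu) -Pa.
rewrite [LHS]adjM [in LHS]adjM adjK mulrA; apply: (congr1 (fun D => adj P *m D *m P)).
rewrite /adj map_diag_mx tr_diag_mx; congr diag_mx.
by apply/rowP => i; rewrite !mxE /= conj_cexpi mulNr.
Qed.

(** The case [c = 0] of intertwining. With [A = B] it gives commutation; with two different slices
    it carries an exponential along the translation. *)
Lemma mexpi_comm A B X (x : R) : adj A = A -> adj B = B ->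
  X * A = B * X -> X * mexpi x A = mexpi x B * X.
Proof.
move=> hA hB XAB; rewrite (@mexpi_intertwine A B X 0 x) //.
  by rewrite mulr0 cexpi0 scale1r.
by rewrite scale0r addr0.
Qed.

End UnitaryGroup.

(** * Basis states as binary numbers *)

Section BinaryDigits.
Local Open Scope nat_scope.

Definition bsum (M : nat) (f : nat -> bool) : nat := \sum_(j < M) f j * 2 ^ j.

Lemma bsumS M f : bsum M.+1 f = f 0 + (bsum M (f \o succn)).*2.
Proof.
rewrite /bsum big_ord_recl /= muln1 -muln2 big_distrl /=; congr (_ + _).
by apply: eq_bigr => j _; rewrite expnSr mulnA.
Qed.

Lemma ltn_bsum M f : bsum M f < 2 ^ M.
Proof.
elim: M f => [|M IH] f; first by rewrite /bsum big_ord0.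
rewrite bsumS expnS mul2n; have := IH (f \o succn).
by case: (f 0) => /=; rewrite ?add0n ?ltn_double // add1n ltn_Sdouble.
Qed.

Lemma occS m n : occ m.+1 n = occ m n./2.
Proof. by rewrite /occ -divn2 expnS divnMA. Qed.

Lemma occ_bsum M m f : m < M -> occ m (bsum M f) = f m.
Proof.
elim: M m f => // M IH [|m] f mM; rewrite bsumS.
  by rewrite /occ divn1 oddD odd_double addbF oddb.
by rewrite occS half_bit_double IH.
Qed.

Lemma bsum_occ M r : r < 2 ^ M -> bsum M (fun j => occ j r) = r.
Proof.
elim: M r => [|M IH] r; first by rewrite /bsum big_ord0; case: r.
move=> rM; rewrite bsumS -[RHS]odd_double_half; congr (_ + _.*2).
  by rewrite /occ divn1.
rewrite -[RHS]IH; first by apply: eq_bigr => j _; rewrite /= occS.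
rewrite -ltn_double (leq_ltn_trans _ (leq_trans rM _)) ?expnS ?mul2n //.
by rewrite -[leqRHS]odd_double_half leq_addl.
Qed.

Definition enc (M : nat) (f : nat -> bool) : 'I_(2 ^ M) := Ordinal (ltn_bsum M f).

Lemma occ_enc M m f : m < M -> occ m (enc M f) = f m.
Proof. exact: occ_bsum. Qed.

Lemma occ_inj M (r s : 'I_(2 ^ M)) :
  (forall j, j < M -> occ j r = occ j s) -> r = s.
Proof.
move=> rs; apply/val_inj => /=; rewrite -(bsum_occ (ltn_ord r)) -(bsum_occ (ltn_ord s)).
by apply: eq_bigr => j _; rewrite rs.
Qed.

(** Toggling a digit, rather than adding or subtracting a power of 2, gives an involution that
    serves creation and annihilation alike. *)
Definition flip M m (r : 'I_(2 ^ M)) : 'I_(2 ^ M) := enc M (fun j => occ j r (+) (j == m)).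

Lemma occ_flip M m k (r : 'I_(2 ^ M)) : k < M -> occ k (flip m r) = occ k r (+) (k == m).
Proof. exact: occ_enc. Qed.

Lemma flipC M m k (r : 'I_(2 ^ M)) : flip k (flip m r) = flip m (flip k r).
Proof. by apply: occ_inj => j jM; rewrite !occ_flip // addbAC. Qed.

Lemma flipK M m : involutive (@flip M m).
Proof. by move=> r; apply: occ_inj => j jM; rewrite !occ_flip // addbK. Qed.

Lemma flip_add M m (r : 'I_(2 ^ M)) : m < M -> ~~ occ m r -> flip m r = r + 2 ^ m :> nat.
Proof.
move=> mM mr; rewrite /= -[in RHS](bsum_occ (ltn_ord r)) /bsum.
rewrite (bigD1 (Ordinal mM)) // [in RHS](bigD1 (Ordinal mM)) //= (negbTE mr) eqxx mul1n mul0n.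
rewrite add0n addnC; congr (_ + _); apply: eq_bigr => j jm.
by have := jm; rewrite -val_eqE /= => /negbTE ->; rewrite addbF.
Qed.

Lemma occ_add_pow m r : occ m (r + 2 ^ m) = ~~ occ m r.
Proof.
by rewrite /occ -[X in (r + X) %/ _](mul1n (2 ^ m)) addnC divnMDl ?expn_gt0.
Qed.

Lemma occ_ge m c : occ m c -> 2 ^ m <= c.
Proof. by apply: contraTT; rewrite -ltnNge /occ => /divn_small ->. Qed.

End BinaryDigits.

(** * Jordan-Wigner operators and their anticommutation relations *)

Section Ladder.
Variable R : realType.
Local Notation C := R[i].

(* the Jordan-Wigner sign *)
Definition sgn (m r : nat) : C := \prod_(j < m) (-1) ^+ occ j r.

Lemma sgnE m r : sgn m r = (-1) ^+ (\sum_(j < m) (occ j r : nat))%N.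
Proof. by rewrite /sgn expr_sum. Qed.

Lemma sgn_sqr m r : sgn m r * sgn m r = 1.
Proof. by rewrite sgnE -expr2 sqrr_sign. Qed.

Lemma conj_sgn m r : Num.conj (sgn m r) = sgn m r.
Proof. by rewrite sgnE rmorphXn /= rmorphN1. Qed.

(** The sign of mode [k] counts the occupied modes below [k]; toggling [m] changes that count by one
    exactly when [m < k]. *)
Lemma sgn_flip M m k (r : 'I_(2 ^ M)) : (k < M)%N ->
  sgn k (flip m r) = (-1) ^+ (m < k)%N * sgn k r.
Proof.
move=> kM; rewrite /sgn.
under eq_bigr => j _ do rewrite occ_flip ?(ltn_trans (ltn_ord j) kM) // signr_addb.
rewrite big_split /= mulrC; congr (_ * _).
rewrite -expr_sum; congr (_ ^+ _).
elim: k {kM} => [|k IH]; first by rewrite big_ord0.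
by rewrite big_ord_recr /= IH ltnS; case: (ltngtP m k).
Qed.

(** Annihilator for [b = false], creator for [b = true]: [b] is the occupation of mode [m] after the
    action. The sign may be read off the row, since toggling [m] leaves the modes below it alone. *)
Definition lad M m (b : bool) : 'M[C]_(2 ^ M) :=
  \matrix_(r, c) if (occ m r == b) && (c == flip m r) then sgn m r else 0.

Lemma ann_lad M m : (m < M)%N -> ann R M m = lad M m false.
Proof.
move=> mM; apply/matrixP => r c; rewrite !mxE.
have -> : occ m c && (r == (c - 2 ^ m)%N :> nat) = (occ m r == false) && (c == flip m r).
  apply/andP/andP => [[mc /eqP rc]|[/eqP mr /eqP ->]].
    (* Occupation of [m] in [c] gives 2^m <= c, so the truncated subtraction is exact. *)
    have cr : c = (r + 2 ^ m)%N :> nat by rewrite rc subnK ?occ_ge.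
    have mr : ~~ occ m r by rewrite -occ_add_pow -cr.
    by split; [rewrite (negbTE mr)|apply/eqP/val_inj; rewrite [RHS]flip_add].
  by rewrite occ_flip // mr eqxx flip_add ?mr // addnK.
case: ifP => // /andP[_ /eqP ->].
by rewrite -sgnE sgn_flip // ltnn mul1r.
Qed.

Lemma adj_lad M m b : (m < M)%N -> adj (lad M m b) = lad M m (~~ b).
Proof.
move=> mM; apply/matrixP => r c; rewrite adjE !mxE.
have -> : (occ m c == b) && (r == flip m c) = (occ m r == ~~ b) && (c == flip m r).
  apply/andP/andP => -[/eqP e /eqP ->]; rewrite flipK occ_flip // e eqxx addbT.
    by [].
  by rewrite negbK.
case: ifP => [/andP[_ /eqP ->]|_]; last by rewrite conjC0.
by rewrite conj_sgn sgn_flip // ltnn mul1r.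
Qed.

(** A row of [lad] has at most one nonzero entry, so products are computed entry by entry without
    sums. *)
Lemma lad_row M m b k (X : 'M[C]_(2 ^ M, k)) r j :
  (lad M m b *m X) r j = if occ m r == b then sgn m r * X (flip m r) j else 0.
Proof.
rewrite mxE (bigD1 (flip m r)) //= big1 => [|c /negbTE cf].
  by rewrite addr0 mxE eqxx andbT; case: ifP; rewrite ?mul0r.
by rewrite mxE cf andbF mul0r.
Qed.

Lemma lad_anticomm M m k b d : (m < M)%N -> (k < M)%N -> m != k ->
  lad M m b * lad M k d = - (lad M k d * lad M m b).
Proof.
move=> mM kM mk; apply/matrixP => r c; rewrite -!mulmxE [RHS]mxE !lad_row !mxE.
rewrite !occ_flip // [k == m]eq_sym (negbTE mk) !addbF flipC.
rewrite !sgn_flip //; case: (occ m r == b); case: (occ k r == d); rewrite /= ?(mulr0, oppr0) //.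
case: eqP => _; rewrite ?(mulr0, oppr0) //.
by move: mk; case: ltngtP => //= _ _; rewrite ?expr0 ?expr1; ring.
Qed.

Lemma lad_sqr M m b : (m < M)%N -> lad M m b * lad M m b = 0.
Proof.
move=> mM; apply/matrixP => r c; rewrite -mulmxE lad_row !mxE occ_flip // eqxx addbT.
by case: eqP => // ->; case: (b); rewrite /= mulr0.
Qed.

Lemma lad_mixed M m : (m < M)%N ->
  lad M m false * lad M m true + lad M m true * lad M m false = 1.
Proof.
move=> mM; apply/matrixP => r c; rewrite -!mulmxE [LHS]mxE !lad_row !mxE.
rewrite !occ_flip // eqxx addbT flipK [c == r]eq_sym sgn_flip // ltnn mul1r.
by case: (occ m r); case: (r == c); rewrite /= ?sgn_sqr ?(mulr0, addr0, add0r).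
Qed.

End Ladder.

(** * Even polynomials in ladder operators *)

Section LadderPolynomials.
Variables (R : realType) (L : nat).
Local Notation C := R[i].
Implicit Types (p : ladder_poly R L) (w : seq (bool * 'I_L)).

Definition letter n (a : 'I_L -> 'M[C]_n) (l : bool * 'I_L) : 'M[C]_n :=
  if l.1 then adj (a l.2) else a l.2.

Lemma eval_word_cons n (a : 'I_L -> 'M[C]_n) l w :
  eval_word a (l :: w) = letter a l * eval_word a w.
Proof. by []. Qed.

Lemma eval_word_rcons n (a : 'I_L -> 'M[C]_n) w l :
  eval_word a (rcons w l) = eval_word a w * letter a l.
Proof.
elim: w => [|l' w IH]; first by rewrite /eval_word /= mulr1 mul1r.
by rewrite rcons_cons !eval_word_cons IH mulrA.
Qed.

Section Intertwining.
Variables (k n : nat) (a : 'I_L -> 'M[C]_n) (b : 'I_L -> 'M[C]_k).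
Variables (W : 'M[C]_(k, n)) (s : C).
Hypothesis Wl : forall l, W *m letter a l = s *: (letter b l *m W).

Lemma eval_word_intertwine w :
  W *m eval_word a w = s ^+ size w *: (eval_word b w *m W).
Proof.
elim: w => [|l w IH]; first by rewrite scale1r mulmx1 mul1mx.
rewrite !eval_word_cons -!mulmxE mulmxA Wl -scalemxAl -mulmxA IH -scalemxAr.
by rewrite scalerA -exprS mulmxA.
Qed.

(** A word of length l picks up s^l, which is 1 for even l. [W] may be rectangular: it serves as a
    restriction to one slice, as an operator on another slice, and as the time translation. *)
Lemma eval_poly_intertwine p : s ^+ 2 = 1 -> parity_even p ->
  W *m eval_poly a p = eval_poly b p *m W.
Proof.
move=> s2 /allP pe; rewrite /eval_poly mulmx_sumr mulmx_suml.
apply: eq_big_seq => m /pe mo.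
rewrite -scalemxAr -scalemxAl eval_word_intertwine.
by rewrite -[size _]odd_double_half (negbTE mo) add0n -mul2n exprM s2 expr1n scale1r.
Qed.

End Intertwining.

(** Keeps the adjoint inside the syntax of polynomials, so that intertwining applies to it as
    well. *)
Definition adj_poly p : ladder_poly R L :=
  [seq (Num.conj m.1, rev [seq (~~ l.1, l.2) | l <- m.2]) | m <- p].

Lemma parity_even_adj p : parity_even p -> parity_even (adj_poly p).
Proof.
move=> /allP pe; apply/allP => _ /mapP [m mp ->] /=.
by rewrite size_rev size_map; exact: pe.
Qed.

Lemma eval_adj_poly n (a : 'I_L -> 'M[C]_n) p :
  eval_poly a (adj_poly p) = adj (eval_poly a p).
Proof.
rewrite /eval_poly raddf_sum big_map; apply: eq_bigr => -[c w] _ /=.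
rewrite adjZ; congr (_ *: _).
elim: w => [|l w IH]; first by rewrite /eval_word /= adj1.
rewrite map_cons rev_cons eval_word_rcons eval_word_cons adjM IH; congr (_ * _).
by case: l => -[] i; rewrite /letter /= ?adjK.
Qed.

End LadderPolynomials.

(** * Hamiltonians placed on slices *)

Section Slices.
Variables (R : realType) (N L : nat).
Local Notation C := R[i].
Implicit Types (p : ladder_poly R L).

Lemma slice_lt t (i : 'I_L) : (t < N)%N -> (t * L + i < N * L)%N.
Proof.
move=> tN; apply: (@leq_trans (t.+1 * L)); last by rewrite leq_mul2r tN orbT.
by rewrite mulSn [(L + _)%N]addnC ltn_add2l.
Qed.

Lemma letter_a_sl t l : (t < N)%N ->
  letter (a_sl R N L t) l = lad R (N * L) (t * L + l.2) l.1.
Proof.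
move=> tN; case: l => -[] i; rewrite /letter /a_sl /= ann_lad ?slice_lt //.
by rewrite adj_lad ?slice_lt.
Qed.

Lemma letter_ann l : letter (fun i : 'I_L => ann R L i) l = lad R L l.2 l.1.
Proof. by case: l => -[] i; rewrite /letter /= ann_lad ?adj_lad. Qed.

Section Selection.
Variables (t : nat) (c : 'I_(2 ^ (N * L))).
Hypothesis tN : (t < N)%N.

(** The state with the digits of [r] on slice [t] and those of the background [c] elsewhere. The
    matrix [rowsub fill 1%:M] selects the rows of the states with that background. *)
Definition fill (r : 'I_(2 ^ L)) : 'I_(2 ^ (N * L)) :=
  enc (N * L) (fun j => if (t * L <= j < t * L + L)%N then occ (j - t * L) r else occ j c).

Lemma occ_fillE j r : (j < N * L)%N ->
  occ j (fill r) = if (t * L <= j < t * L + L)%N then occ (j - t * L) r else occ j c.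
Proof. exact: occ_enc. Qed.

Lemma occ_fill (i : nat) r : (i < L)%N -> occ (t * L + i) (fill r) = occ i r.
Proof.
move=> iL; rewrite occ_enc ?(slice_lt (Ordinal iL)) //.
by rewrite leq_addr ltn_add2l iL addKn.
Qed.

Lemma fill_flip (i : 'I_L) r : fill (flip i r) = flip (t * L + i) (fill r).
Proof.
apply: occ_inj => j jM; rewrite occ_flip // !occ_fillE //.
case: ifP => [/andP[tj jt]|tj].
  rewrite occ_flip ?ltn_subLR //; congr (_ (+) _).
  by rewrite -[in RHS](subnKC tj) eqn_add2l.
case: eqP => [jE|_]; last by rewrite addbF.
by move: tj; rewrite jE leq_addr ltn_add2l ltn_ord.
Qed.

(** The Jordan-Wigner string splits at the start of the slice: the earlier modes give a sign that
    depends only on the background, the others the sign within one copy. The constant sign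
    disappears from even polynomials. *)
Lemma sgn_fill (i : 'I_L) r :
  sgn R (t * L + i) (fill r) = sgn R (t * L) c * sgn R i r.
Proof.
rewrite /sgn big_split_ord /=; congr (_ * _); apply: eq_bigr => j _; last first.
  by rewrite occ_fill // (ltn_trans (ltn_ord j)).
rewrite occ_enc; first by rewrite leqNgt ltn_ord.
by rewrite (leq_trans (ltn_ord j)) // leq_mul2r ltnW ?orbT.
Qed.

Lemma rowsub_fill_lad (i : 'I_L) b :
  rowsub fill 1%:M *m lad R (N * L) (t * L + i) b =
  sgn R (t * L) c *: (lad R L i b *m rowsub fill 1%:M).
Proof.
rewrite mul_rowsub_mx mul1mx; apply/matrixP => r j; rewrite [RHS]mxE lad_row !mxE.
rewrite occ_fill // sgn_fill fill_flip [_ == j]eq_sym.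
by case: (_ == b); case: eqP => _ /=; rewrite ?mulr0 ?mulr1.
Qed.

Lemma rowsub_fill_H p : parity_even p ->
  rowsub fill 1%:M *m H_slice N p t =
  eval_poly (fun i : 'I_L => ann R L i) p *m rowsub fill 1%:M.
Proof.
apply: (eval_poly_intertwine (s := sgn R (t * L) c)); last by rewrite expr2 sgn_sqr.
by move=> l; rewrite letter_a_sl // letter_ann rowsub_fill_lad.
Qed.

End Selection.

(** Every state is its own background filled with its own slice digits, so the selected rows, over
    all backgrounds, exhaust the matrix. *)
Lemma fill_surj t (r : 'I_(2 ^ (N * L))) :
  fill t r (enc L (fun j => occ (t * L + j) r)) = r.
Proof.
apply: occ_inj => j jM; rewrite occ_enc //; case: ifP => // /andP[tj jt].
by rewrite occ_enc ?ltn_subLR // subnKC.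
Qed.

(* Even polynomials act on slice t as on a single copy of the Fock space, whatever
   the state of the other slices, so identities between them carry over. *)
Lemma adj_H_slice p t : (t < N)%N -> parity_even p ->
  adj (eval_poly (fun i : 'I_L => ann R L i) p) = eval_poly (fun i : 'I_L => ann R L i) p ->
  adj (H_slice N p t) = H_slice N p t.
Proof.
move=> tN pe hp; apply/row_matrixP => r.
have : rowsub (fill t r) 1%:M *m adj (H_slice N p t) = rowsub (fill t r) 1%:M *m H_slice N p t.
  rewrite -eval_adj_poly [LHS](rowsub_fill_H r tN (parity_even_adj pe)).
  by rewrite rowsub_fill_H // eval_adj_poly hp.
rewrite !mul_rowsub_mx !mul1mx => /row_matrixP /(_ (enc L (fun j => occ (t * L + j) r))).
by rewrite !row_rowsub fill_surj.
Qed.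

Lemma slice_neq t t' (i j : 'I_L) : t != t' -> (t * L + i != t' * L + j)%N.
Proof.
apply: contra => /eqP /(congr1 (fun x => x %/ L)%N).
have L0 : (0 < L)%N by case: L i => [[]|].
by rewrite !divnMDl // !divn_small // !addn0 => ->.
Qed.

(** A letter of slice [t'] anticommutes with each letter of slice [t], hence passes the even [p]
    without a sign; the words of [q] then pass letter by letter. *)
Lemma H_slice_comm p q t t' : (t < N)%N -> (t' < N)%N -> t != t' ->
  parity_even p -> parity_even q ->
  H_slice N p t * H_slice N q t' = H_slice N q t' * H_slice N p t.
Proof.
move=> tN tN' tt pe qe; rewrite -!mulmxE /H_slice.
apply: (eval_poly_intertwine (s := 1)) => //; last by rewrite expr1n.
move=> l; rewrite scale1r; apply/esym.
apply: (eval_poly_intertwine (s := -1)) => //; last by rewrite sqrrN expr1n.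
move=> l'; rewrite !letter_a_sl // !mulmxE lad_anticomm ?slice_lt ?scaleN1r //.
by rewrite slice_neq // eq_sym.
Qed.

End Slices.

(** * Fourier modes and the translation operator *)

Section TimeTranslation.
Variables (R : realType) (N L : nat) (eps : R).
Hypotheses (N0 : (0 < N)%N) (eps0 : 0 < eps).
Local Notation C := R[i].
Local Notation A := (a_sl R N L).
Local Notation b := (ahat eps N L).
Local Notation w := (omega eps N).

(** A unitary discrete Fourier matrix with half-integer frequencies, hence antiperiodic in [t] with
    period [N]. *)
Definition fourier (n t : nat) : C :=
  ((Num.sqrt (N%:R : R))^-1)%:C * cexpi (w n * eps * t%:R).

Lemma ahatE n j : b n j = \sum_(t < N) fourier n t *: A t j.
Proof.
by rewrite /ahat scaler_sumr; apply: eq_bigr => t _; rewrite scalerA.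
Qed.

Lemma omegaM n : w n * eps * N%:R = (2 * n + 1)%:R * pi.
Proof.
have N1 : N%:R != 0 :> R by rewrite pnatr_eq0 -lt0n.
by rewrite /omega; field; rewrite N1 gt_eqF.
Qed.

(** If cos x were 1, then cos x = 1 - 2 sin(x/2)^2 would force sin(x/2) = 0, while x/2 lies strictly
    between 0 and pi. *)
Lemma cexpi_neq1 (x : R) : 0 < x < pi *+ 2 -> cexpi x != 1.
Proof.
move=> /andP[x0 x2]; apply/eqP => -[cx _].
have s0 : 0 < sin (x / 2).
  by apply: sin_gt0_pi; rewrite divr_gt0 //= ltr_pdivrMr // mulr_natr.
have : cos x = 1 - sin (x / 2) ^+ 2 *+ 2.
  by rewrite {1}(splitr x) cosD -!expr2 cos2sin2; ring.
rewrite cx => /eqP; rewrite -subr_eq0 opprB addrC subrK mulrn_eq0 /= sqrf_eq0.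
by rewrite gt_eqF.
Qed.

Lemma cexpiX (x : R) k : cexpi x ^+ k = cexpi (x * k%:R).
Proof.
elim: k => [|k IH]; first by rewrite mulr0 cexpi0.
by rewrite exprS IH -cexpiD -nat1r mulrDr mulr1.
Qed.

Lemma cexpi_odd_pi n : cexpi ((2 * n + 1)%:R * pi : R) = -1.
Proof.
rewrite mulrC -cexpiX.
have -> : cexpi pi = -1 :> C by rewrite /cexpi cospi sinpi; apply/eqP; rewrite eq_complex /= oppr0 !eqxx.
by rewrite exprD mulnC exprM -signr_odd; rewrite sqrr_sign mul1r.
Qed.

(** For [m != n] this is a geometric sum with ratio q != 1. Both phases over the whole period are
    -1, so q^N = 1 and the sum vanishes. *)
Lemma fourier_orthonormal m n : (m < N)%N -> (n < N)%N ->
  \sum_(t < N) fourier m t * Num.conj (fourier n t) = (m == n)%:R.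
Proof.
move=> mN nN.
have N1 : N%:R != 0 :> R by rewrite pnatr_eq0 -lt0n.
have -> : \sum_(t < N) fourier m t * Num.conj (fourier n t) =
    (N%:R^-1)%:C * \sum_(t < N) cexpi ((w m - w n) * eps) ^+ t.
  rewrite mulr_sumr; apply: eq_bigr => t _.
  rewrite /fourier rmorphM /= conj_real_complex conj_cexpi cexpiX mulrACA -rmorphM -invfM -expr2.
  by rewrite sqr_sqrtr ?ler0n // -cexpiD; congr (_ * cexpi _); ring.
have [->|mn] := eqVneq m n.
  rewrite subrr mul0r cexpi0.
  under eq_bigr do rewrite expr1n.
  by rewrite sumr_const card_ord -(rmorph_nat (real_complex R)) -rmorphM mulVf.
suff q1 : cexpi ((w m - w n) * eps) != 1.
  have : (cexpi ((w m - w n) * eps) - 1) * \sum_(t < N) cexpi ((w m - w n) * eps) ^+ t = 0.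
    rewrite -subrX1 cexpiX mulrBl mulrBl !omegaM -[_ - _ * pi]/(_ + _) cexpiD -conj_cexpi.
    by rewrite !cexpi_odd_pi rmorphN1 mulrNN mulr1 subrr.
  move=> /eqP; rewrite mulf_eq0 subr_eq0 (negbTE q1) /= => /eqP ->.
  by rewrite mulr0.
(* The angle is 2 pi (k - l) / N with 0 < k - l < N. *)
have wE (k l : nat) : (l < k)%N -> (k < N)%N -> 0 < (w k - w l) * eps < pi *+ 2.
  move=> lk kN.
  have -> : (w k - w l) * eps = (k - l)%:R / N%:R * pi *+ 2.
    have e1 : eps != 0 by rewrite gt_eqF.
    have oE m' : (2 * m' + 1)%:R = 2 * m'%:R + 1 :> R by rewrite natrD natrM.
    rewrite natrB ?(ltnW lk) // /omega !oE; field.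
    by rewrite N1 e1.
  have pi0 := pi_gt0 R.
  have NR : 0 < N%:R :> R by rewrite ltr0n.
  rewrite pmulrn_lgt0 // ltrMn2r /= mulr_gt0 ?divr_gt0 ?ltr0n ?subn_gt0 //=.
  rewrite gtr_pMl // ltr_pdivrMr // mul1r ltr_nat.
  by rewrite (leq_ltn_trans (leq_subr _ _)).
have [lt_mn|lt_nm|/eqP] := ltngtP m n; last by rewrite (negbTE mn).
  (* For [m < n] the angle is negative, and the bound is applied to the conjugate phase. *)
  apply/negP => /eqP e; have := cexpi_neq1 (wE _ _ lt_mn nN).
  by rewrite -opprB mulNr -conj_cexpi e rmorph1 eqxx.
exact: cexpi_neq1 (wE _ _ lt_nm mN).
Qed.

(** A right inverse of a square matrix is also a left inverse. *)
Lemma fourier_complete s t : (s < N)%N -> (t < N)%N ->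
  \sum_(n < N) Num.conj (fourier n s) * fourier n t = (s == t)%:R.
Proof.
move=> sN tN.
pose F : 'M[C]_N := \matrix_(n, s) fourier n s.
have FF : F *m adj F = 1%:M.
  apply/matrixP => m n; rewrite !mxE -(inj_eq val_inj) /= -fourier_orthonormal //.
  by apply: eq_bigr => k _; rewrite adjE !mxE.
have := mulmx1C FF => /matrixP /(_ (Ordinal sN) (Ordinal tN)).
rewrite !mxE -(inj_eq val_inj) /= => <-.
by apply: eq_bigr => k _; rewrite adjE !mxE.
Qed.

Lemma ahat_inv t j : (t < N)%N -> A t j = \sum_(n < N) Num.conj (fourier n t) *: b n j.
Proof.
move=> tN; under eq_bigr => n _ do rewrite ahatE scaler_sumr.
rewrite exchange_big /= (bigD1 (Ordinal tN)) //= [X in _ + X]big1 => [|s st].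
  rewrite addr0; under eq_bigr do rewrite scalerA.
  by rewrite -scaler_suml fourier_complete // eqxx scale1r.
under eq_bigr do rewrite scalerA.
rewrite -scaler_suml fourier_complete //.
by rewrite -val_eqE eq_sym /= in st; rewrite (negbTE st) scale0r.
Qed.

Lemma a_sl_lad t j : (t < N)%N -> A t j = lad R (N * L) (t * L + j) false.
Proof. by move=> tN; rewrite -(letter_a_sl R (false, j) tN). Qed.

Lemma adj_a_sl_lad t j : (t < N)%N -> adj (A t j) = lad R (N * L) (t * L + j) true.
Proof. by move=> tN; rewrite -(letter_a_sl R (true, j) tN). Qed.

Lemma slice_eqE t t' (i j : 'I_L) : (t * L + i == t' * L + j)%N = (t == t') && (i == j).
Proof.
have [->|tt] := eqVneq t t'; first by rewrite eqn_add2l.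
by rewrite (negbTE (slice_neq _ _ tt)).
Qed.

Lemma a_sl_anticomm t t' i j : (t < N)%N -> (t' < N)%N ->
  A t i * A t' j = - (A t' j * A t i).
Proof.
move=> tN tN'; rewrite !a_sl_lad //.
have [e|ne] := eqVneq (t * L + i)%N (t' * L + j)%N.
  by rewrite e lad_sqr ?slice_lt // oppr0.
by rewrite lad_anticomm ?slice_lt.
Qed.

Lemma a_sl_adj_anticomm t t' i j : (t < N)%N -> (t' < N)%N ->
  A t i * adj (A t' j) + adj (A t' j) * A t i = ((t == t') && (i == j))%:R%:M.
Proof.
move=> tN tN'; rewrite adj_a_sl_lad // a_sl_lad // -slice_eqE.
have [e|ne] := eqVneq (t * L + i)%N (t' * L + j)%N.
  by rewrite e lad_mixed ?slice_lt.
by rewrite lad_anticomm ?slice_lt // addNr raddf0.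
Qed.

Lemma ahat_anticomm n m i j : b n i * b m j = - (b m j * b n i).
Proof.
rewrite !ahatE !mulr_suml -sumrN.
under [RHS]eq_bigr do rewrite mulr_sumr -sumrN.
rewrite exchange_big /=; apply: eq_bigr => t _; rewrite mulr_sumr.
apply: eq_bigr => s _.
by rewrite -!mxscaleAl -!mxscaleAr a_sl_anticomm // !scalerN !scalerA mulrC.
Qed.

Lemma ahat_adj_anticomm n m i j : (n < N)%N -> (m < N)%N ->
  b n i * adj (b m j) + adj (b m j) * b n i = ((n == m) && (i == j))%:R%:M.
Proof.
move=> nN mN.
have -> : b n i * adj (b m j) + adj (b m j) * b n i =
    \sum_(t < N) \sum_(s < N) (fourier n t * Num.conj (fourier m s)) *:
      (A t i * adj (A s j) + adj (A s j) * A t i).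
  rewrite !ahatE raddf_sum !mulr_suml.
  under [X in _ + X]eq_bigr do rewrite mulr_sumr.
  rewrite [X in _ + X]exchange_big /= -big_split /=; apply: eq_bigr => t _.
  rewrite mulr_sumr -big_split /=; apply: eq_bigr => s _.
  by rewrite adjZ -!mxscaleAl -!mxscaleAr !scalerA scalerDr [Num.conj _ * _]mulrC.
have -> : \sum_(t < N) \sum_(s < N) (fourier n t * Num.conj (fourier m s)) *:
      (A t i * adj (A s j) + adj (A s j) * A t i) =
    \sum_(t < N) (fourier n t * Num.conj (fourier m t)) *: ((i == j)%:R%:M : 'M[C]_(2 ^ (N * L))).
  apply: eq_bigr => t _; rewrite (bigD1 t) //= [X in _ + X]big1 => [|s st].
    by rewrite addr0 a_sl_adj_anticomm // eqxx.
  by rewrite a_sl_adj_anticomm // eq_sym (inj_eq val_inj) (negbTE st) raddf0 scaler0.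
rewrite -scaler_suml fourier_orthonormal // scale_scalar_mx -natrM.
by rewrite mulnb.
Qed.

Lemma adj_Pgen : adj (Pgen eps N L) = Pgen eps N L.
Proof.
rewrite /Pgen raddf_sum; apply: eq_bigr => n _; rewrite raddf_sum; apply: eq_bigr => j _.
by rewrite /= adjZ conj_real_complex adjM adjK.
Qed.

(** Uses x y z = {x, y} z - y x z and x z = - z x, with x = b_m, y = b_n^dagger, z = b_n; only the
    term with equal indices leaves a remainder. The form is the one that [mexpi_intertwine] expects,
    with shift [w m]. *)
Lemma ahat_Pgen m j : (m < N)%N ->
  b m j * Pgen eps N L = Pgen eps N L * b m j + (w m)%:C *: b m j.
Proof.
move=> mN; rewrite /Pgen mulr_sumr mulr_suml.
have comm n i : (n < N)%N ->
    b m j * ((w n)%:C *: (adj (b n i) * b n i)) =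
    ((w n)%:C *: (adj (b n i) * b n i)) * b m j +
      ((n == m) && (i == j))%:R *: ((w n)%:C *: b n i).
  move=> nN; rewrite -mxscaleAr -mxscaleAl mulrA.
  have /(canRL (addrK _)) -> := ahat_adj_anticomm j i mN nN.
  rewrite mulrBl -[_ * b m j * _]mulrA ahat_anticomm mulrN opprK mulrA.
  rewrite scalerDr addrC; congr (_ + _).
  have -> k : k%:M * b n i = k *: b n i by exact: mul_scalar_mx.
  by rewrite [m == n]eq_sym [j == i]eq_sym [LHS]scalerA [RHS]scalerA mulrC.
under eq_bigr => n _.
  rewrite mulr_sumr; under eq_bigr => i _ do rewrite comm //.
  rewrite big_split /= -mulr_suml.
  over.
rewrite big_split /=; congr (_ + _).
rewrite (bigD1 (Ordinal mN)) //= [X in _ + X]big1 => [|n nm].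
  rewrite addr0 (bigD1 j) //= big1 ?addr0 ?eqxx ?scale1r // => i ij.
  by rewrite (negbTE ij) andbF scale0r.
apply: big1 => i _; rewrite -val_eqE /= in nm.
by rewrite (negbTE nm) scale0r.
Qed.

Local Notation U := (mexpi eps (Pgen eps N L)).

Lemma translate_ahat m j : (m < N)%N -> U * b m j = cexpi (- (eps * w m)) *: (b m j * U).
Proof.
move=> mN; have hP := adj_Pgen.
rewrite (mexpi_intertwine eps hP hP (ahat_Pgen j mN)) scalerA -cexpiD addNr.
by rewrite cexpi0 scale1r.
Qed.

Lemma translate_a_sl t j : (t < N)%N ->
  U * A t j = (-1) ^+ (t.+1 == N) *: (A (t.+1 %% N) j * U).
Proof.
move=> tN; rewrite ahat_inv // [in RHS]ahat_inv ?ltn_mod // mulr_sumr mulr_suml scaler_sumr.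
apply: eq_bigr => n _; rewrite -mxscaleAr -mxscaleAl translate_ahat // !scalerA; congr (_ *: _).
rewrite /fourier !rmorphM /= !conj_real_complex !conj_cexpi [RHS]mulrCA -[LHS]mulrA -cexpiD; congr (_ * _).
(* The translation phase turns the conjugate Fourier coefficient at [t] into the one at [t.+1]. *)
have -> : - (w n * eps * t%:R) + - (eps * w n) = - (w n * eps * t.+1%:R) by rewrite -nat1r; ring.
(* At the wrap the phase is that of an odd multiple of pi, which is the source of the sign. *)
have [tE|tN'] := eqVneq t.+1 N.
  by rewrite tE modnn mulr0 oppr0 cexpi0 mulr1 expr1 omegaM -conj_cexpi cexpi_odd_pi rmorphN1.
by rewrite expr0 mul1r modn_small // ltn_neqAle tN' tN.
Qed.

End TimeTranslation.

(** * Translation of the slice evolutions *)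

Section TranslateHamiltonian.
Variables (R : realType) (N L : nat) (eps : R) (p : ladder_poly R L).
Hypotheses (N0 : (0 < N)%N) (eps0 : 0 < eps) (pe : parity_even p).
Local Notation C := R[i].
Local Notation U := (mexpi eps (Pgen eps N L)).

Lemma translation_unitary : adj U * U = 1 /\ U * adj U = 1.
Proof.
have hP := adj_Pgen N L eps.
rewrite (adj_mexpi _ hP); split.
  by rewrite -(mexpiD (- eps) eps hP) addNr (mexpi0 hP).
by rewrite -(mexpiD eps (- eps) hP) subrr (mexpi0 hP).
Qed.

Lemma translate_H_slice t : (t < N)%N ->
  U * H_slice N p t = H_slice N p (t.+1 %% N) * U.
Proof.
move=> tN; have [VU UV] := translation_unitary.
pose s : C := (-1) ^+ (t.+1 == N).
have Ut j : U * a_sl R N L t j = s *: (a_sl R N L (t.+1 %% N) j * U) by exact: translate_a_sl.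
apply: (eval_poly_intertwine (s := s)) => //; last by rewrite sqrr_sign.
case=> -[] j; rewrite /letter /= !mulmxE; last exact: Ut.
(* For creators, the adjoint of the relation has [adj U] on the outer sides; unitarity moves [U]
   back across. *)
have := congr1 adj (Ut j); rewrite adjM adjZ adjM /s rmorphXn /= rmorphN1 -/s => e.
rewrite -[adj (a_sl _ _ _ _ _)]mulr1 -VU !mulrA -[U * _ * _]mulrA e.
by rewrite -mxscaleAr -!mxscaleAl !mulrA UV mul1r.
Qed.

Hypothesis hp : adj (eval_poly (fun i : 'I_L => ann R L i) p) =
  eval_poly (fun i : 'I_L => ann R L i) p.

Definition evolve (t : nat) (x : R) : 'M[C]_(2 ^ (N * L)) := mexpi x (H_slice N p t).

Lemma evolveD t x y : (t < N)%N -> evolve t (x + y) = evolve t x * evolve t y.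
Proof. by move=> tN; apply/mexpiD/adj_H_slice. Qed.

Lemma evolve0 t : (t < N)%N -> evolve t 0 = 1.
Proof. by move=> tN; apply/mexpi0/adj_H_slice. Qed.

Lemma adj_evolve t x : (t < N)%N -> adj (evolve t x) = evolve t (- x).
Proof. by move=> tN; apply/adj_mexpi/adj_H_slice. Qed.

(** On distinct slices one Hamiltonian is exponentiated at a time; on the same slice the group law
    is symmetric in [x] and [y]. *)
Lemma evolve_comm s t x y : (s < N)%N -> (t < N)%N ->
  evolve s x * evolve t y = evolve t y * evolve s x.
Proof.
move=> sN tN; have [->|st] := eqVneq s t.
  transitivity (evolve t (x + y)); first exact/esym/evolveD.
  by rewrite [x + y]addrC; exact: evolveD.
have hs := adj_H_slice sN pe hp; have ht := adj_H_slice tN pe hp.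
apply: (mexpi_comm y ht ht); apply/esym/(mexpi_comm x hs hs).
by apply: H_slice_comm; rewrite // eq_sym.
Qed.

(** The adjoint reverses the order of the factors, and commutation restores it. *)
Lemma adj_prod_evolve (x : nat -> R) r : (r <= N)%N ->
  adj (\prod_(t < r) evolve t (x t)) = \prod_(t < r) evolve t (- x t).
Proof.
elim: r => [|r IH] rN; first by rewrite [in LHS]big_ord0 big_ord0 adj1.
rewrite [in LHS]big_ord_recr big_ord_recr adjM (IH (ltnW rN)) (adj_evolve _ rN).
apply: commr_prod => t _; apply: evolve_comm => //.
by rewrite (ltn_trans (ltn_ord t)).
Qed.

Lemma translate_evolve t x : (t < N)%N ->
  U * evolve t x = evolve (t.+1 %% N) x * U.
Proof.
move=> tN; have tN' : (t.+1 %% N < N)%N by rewrite ltn_mod.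
apply: mexpi_comm (translate_H_slice tN); exact: adj_H_slice.
Qed.

End TranslateHamiltonian.

(** * Commuting one-parameter groups under a cyclic shift *)

Section CommutingGroups.
Variables (R : realType) (A : pzRingType) (n : nat) (E : nat -> R -> A).
Hypothesis EC : forall s t x y, (s <= n)%N -> (t <= n)%N -> E s x * E t y = E t y * E s x.
Hypothesis ED : forall t x y, (t <= n)%N -> E t (x + y) = E t x * E t y.

(** The reindexing [f] allows products over slices 1 to n, through [f = S]. *)
Lemma prod_comm (r : nat) (f : nat -> nat) (x : nat -> R) s y : (s <= n)%N ->
  (forall t, (t < r)%N -> (f t <= n)%N) ->
  E s y * (\prod_(t < r) E (f t) (x t)) = (\prod_(t < r) E (f t) (x t)) * E s y.
Proof.
move=> sn fn; apply: commr_prod => t _; apply: EC => //; exact: fn.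
Qed.

Lemma prodD (r : nat) (f : nat -> nat) (x y : nat -> R) :
  (forall t, (t < r)%N -> (f t <= n)%N) ->
  (\prod_(t < r) E (f t) (x t)) * (\prod_(t < r) E (f t) (y t)) =
  \prod_(t < r) E (f t) (x t + y t).
Proof.
elim: r => [|r IH] fn; first by rewrite !big_ord0 mulr1.
have fn' t : (t < r)%N -> (f t <= n)%N by move=> tr; apply: fn; rewrite ltnW.
rewrite !big_ord_recr /= ED ?fn // -IH // -!mulrA; congr (_ * _).
rewrite !mulrA; congr (_ * _).
by rewrite (prod_comm y) ?fn.
Qed.

Variables (U : A) (eps : R).
Hypothesis E0 : forall t, (t <= n)%N -> E t 0 = 1.
Hypothesis UE : forall t x, (t <= n)%N -> U * E t x = E (t.+1 %% n.+1) x * U.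

(** The first [n] factors move up by one without wrapping; the last one lands on slice 0. *)
Lemma translate_prod (x : nat -> R) :
  U * \prod_(t < n.+1) E t (x t) = (\prod_(t < n) E t.+1 (x t)) * E 0 (x n) * U.
Proof.
rewrite big_ord_recr mulrA /=.
have -> r : (r <= n)%N -> U * \prod_(t < r) E t (x t) = (\prod_(t < r) E t.+1 (x t)) * U.
- elim: r => [|r IH] rn; first by rewrite !big_ord0 mulr1 mul1r.
  rewrite !big_ord_recr /= mulrA IH ?(ltnW rn) // -!mulrA UE ?(ltnW rn) //.
  by rewrite modn_small.
- by rewrite -!mulrA UE // modnn.
by [].
Qed.

(* U carries every exponential one slice further, so conjugating V by U shifts its
   exponents by one unit; the last slice wraps around to slice 0. *)
Lemma translate_prod_conj :
  U * \prod_(t < n.+1) E t (- eps) =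
  E 0 (- (eps * n.+1%:R)) * (\prod_(t < n.+1) E t (- (eps * t%:R))) *
    U * \prod_(t < n.+1) E t (eps * t%:R).
Proof.
rewrite -mulrA (translate_prod (fun=> - eps)) (translate_prod (fun t => eps * t%:R)).
(* The slice 0 factor of the adjoint of V has exponent 0 and drops out, leaving slices 1 to n on
   both sides. *)
rewrite big_ord_recl /= mulr0 oppr0 E0 // mul1r !mulrA; congr (_ * _).
rewrite -[_ * _ * (\prod_(i < n) _)]mulrA.
rewrite (prodD (f := S) (fun t => - (eps * t.+1%:R)) (fun t => eps * t%:R)) //.
rewrite [X in E 0 _ * X](eq_bigr (fun t : 'I_n => E t.+1 (- eps))) => [|t _]; last first.
  by congr E; rewrite -nat1r; ring.
(* On slice 0 the prefactor meets the wrapped factor: - eps (n + 1) + eps n = - eps. *)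
rewrite (prod_comm (f := S) (fun=> - eps)) // -mulrA -ED //.
by congr (_ * E _ _); rewrite -nat1r; ring.
Qed.

End CommutingGroups.

(** * Specialization to the exponentials of the slice Hamiltonians *)

Theorem theorem3 (R : realType) (L N : nat) (eps : R)
  (HL : (1 <= L)%N) (HN : (1 <= N)%N) (Heps : 0 < eps)
  (H : ladder_poly R L)
  (Hherm : adj (eval_poly (fun i : 'I_L => ann R L i) H) = eval_poly (fun i : 'I_L => ann R L i) H)
  (Hpar : parity_even H) :
  let T := eps * N%:R in
  let eiS := mexp (iC * eps%:C *: Pgen eps N L) *
             \prod_(t < N) mexp (- (iC * eps%:C) *: H_slice N H t) in
  let V := \prod_(t < N) mexp (iC * (eps * t%:R)%:C *: H_slice N H t) in
  eiS = mexp (- (iC * T%:C) *: H_slice N H 0) * adj V *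
        mexp (iC * eps%:C *: Pgen eps N L) * V.
Proof.
case: N HN => [HN|n _]; first by case: (notF HN).
move=> T eiS V.
(* With [N = n.+1], the bounds [t <= n] and [t < N] are convertible, so the slice facts fit the
   abstract hypotheses directly. *)
have EC s t x y (sn : (s <= n)%N) (tn : (t <= n)%N) := evolve_comm (N := n.+1) Hpar Hherm x y sn tn.
have ED t x y (tn : (t <= n)%N) := evolveD (N := n.+1) Hpar Hherm x y tn.
have E0 t (tn : (t <= n)%N) := evolve0 (N := n.+1) Hpar Hherm tn.
have UE t x (tn : (t <= n)%N) := translate_evolve (ltn0Sn n) Heps Hpar Hherm x tn.
have adjV : adj V = \prod_(t < n.+1) evolve n.+1 H t (- (eps * t%:R)).
  exact: (adj_prod_evolve Hpar Hherm (fun t => eps * t%:R) (leqnn n.+1)).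
have eE : \prod_(t < n.+1) mexp (- (iC * eps%:C) *: H_slice n.+1 H t) =
    \prod_(t < n.+1) evolve n.+1 H t (- eps).
  by apply: eq_bigr => t _; exact: (esym (mexpiN _ _)).
have e0 : mexp (- (iC * T%:C) *: H_slice n.+1 H 0) = evolve n.+1 H 0 (- T).
  exact: (esym (mexpiN _ _)).
rewrite /eiS e0 eE adjV.
exact: (translate_prod_conj EC ED eps E0 UE).
Qed.
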